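(* Let $m,n\ge 2$ and let $A\in\mathbb{R}_+^{m\times n}$ be a given (entrywise) nonnegative matrix. Let $\mathbf{b}\in\mathbb{R}^m$ and $\mathbf{a},\mathbf{c}\in\mathbb{R}^n$ be given vectors with positive entries that satisfy $\mathbf{c}^\top\mathbf{a}=\mathbf{1}_m^\top\mathbf{b}$. Then there exists a scaling of $A$, denoted $B$, such that $$B\mathbf{a}=\mathbf{b},\qquad B^\top\mathbf{1}_m=\mathbf{c},$$ if and only if there exists $C\in\mathbb{R}_+^{m\times n}$ with the same $0$-pattern as $A$ (i.e. $c_{i,j}=0\iff a_{i,j}=0$ for the entries of $C$ and $A$) such that $C\mathbf{a}=\mathbf{b}$ and $C^\top\mathbf{1}_m=\mathbf{c}$. If this condition holds then $B$ is unique and can be found by the modified algorithm, in the following sense: for every starting point, the modified algorithm described in the context, applied to the matrix $\tilde A=A\,\mathrm{diag}(\mathbf{a})$ with prescribed row sum vector $\mathbf{s}_1=\mathbf{b}$ and prescribed column sum vector $\mathbf{s}_2=(c_1a_1,\ldots,c_na_n)^\top$, produces a sequence converging to a point $(\mathbf{u}^\star,\mathbf{v}^\star)\in\mathbb{R}^m\times\mathbb{R}^n$ such that $[e^{u_i^\star+v_j^\star}\tilde a_{i,j}]$ is a positive multiple of $B\,\mathrm{diag}(\mathbf{a})$, the scaling of $\tilde A$ with row sums $\mathbf{s}_1$ and column sums $\mathbf{s}_2$.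
   Context: $\mathbf{1}_m=(1,\ldots,1)^\top\in\mathbb{R}^m$. A scaling of a nonnegative matrix $A$ is a matrix of the form $D_1AD_2$ with $D_1,D_2$ diagonal matrices with positive diagonal entries. $\mathrm{diag}(\mathbf{a})$ is the diagonal matrix with diagonal entries $a_1,\ldots,a_n$. Modified algorithm (matrix case) for $\tilde A=[\tilde a_{i,j}]\in\mathbb{R}_+^{m\times n}$ without zero rows or columns and positive vectors $\mathbf{s}_1\in\mathbb{R}^m$, $\mathbf{s}_2\in\mathbb{R}^n$ with equal coordinate sums: Let $L(\mathbf{s})=\{\mathbf{x}:\mathbf{s}^\top\mathbf{x}=0\}$ and $U=L(\mathbf{s}_1)\times L(\mathbf{s}_2)\subset\mathbb{R}^m\times\mathbb{R}^n$, and for $(\mathbf{u},\mathbf{v})\in U$ let $\tilde f(\mathbf{u},\mathbf{v})=\sum_{i,j}\tilde a_{i,j}e^{u_i+v_j}$. Let $V_0=\{(\mathbf{u},\mathbf{v})\in U: u_i+v_j=0 \text{ whenever } \tilde a_{i,j}>0\}$, let $V_0^\perp$ be the orthogonal complement of $V_0$ in $U$, let $P_0:U\to V_0^\perp$ be the orthogonal projection, and let $f$ be the restriction of $\tilde f$ to $V_0^\perp$. Let $W_1=\{P_0(\mathbf{u},\mathbf{0}):\mathbf{u}\in L(\mathbf{s}_1)\}$ and $W_2=\{P_0(\mathbf{0},\mathbf{v}):\mathbf{v}\in L(\mathbf{s}_2)\}$, and let $\nabla_{W_l}f(\mathbf{x})$ denote the gradient of $f$ at $\mathbf{x}$ along the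 subspace $W_l$, with respect to an orthonormal basis of $W_l$ (i.e. the orthogonal projection of the gradient onto $W_l$). Start from any $\mathbf{x}_0\in V_0^\perp$. For $k=0,1,2,\ldots$, write $\mathbf{x}_k=(\mathbf{u}_k,\mathbf{v}_k)\in U$ and choose any $j\in\arg\max\{\|\nabla_{W_l}f(\mathbf{x}_k)\| : l\in\{1,2\}\}$; if $j=1$ set $\mathbf{x}_{k+1}=P_0(\mathbf{u}',\mathbf{v}_k)$, where $\mathbf{u}'$ is the unique minimizer of $\mathbf{u}\mapsto\tilde f(\mathbf{u},\mathbf{v}_k)$ over $L(\mathbf{s}_1)$; if $j=2$ set $\mathbf{x}_{k+1}=P_0(\mathbf{u}_k,\mathbf{v}')$, where $\mathbf{v}'$ is the unique minimizer of $\mathbf{v}\mapsto\tilde f(\mathbf{u}_k,\mathbf{v})$ over $L(\mathbf{s}_2)$. (If $V_0=\{\mathbf{0}\}$ then $P_0$ is the identity.) *)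

(* Defs.v *)
From HB Require Import structures.
From mathcomp Require Import all_boot all_order all_algebra.
From mathcomp Require Import all_classical all_reals all_analysis.
Import Order.TTheory GRing.Theory Num.Theory.
Import numFieldNormedType.Exports.

Set Implicit Arguments.
Unset Strict Implicit.
Unset Printing Implicit Defensive.

Local Open Scope classical_set_scope.
Local Open Scope ring_scope.

Section MatrixScaling.
Context {R : realType} {m n : nat}.
Implicit Types (A B C : 'M[R]_(m, n)).

Definition nonneg_mx A : Prop := forall i j, 0 <= A i j.

Definition same_zero_pattern C A : Prop :=
  forall i j, C i j = 0 <-> A i j = 0.

Definition is_scaling A B : Prop :=
  exists (d1 : 'rV[R]_m) (d2 : 'rV[R]_n),
    [/\ forall i, 0 < d1 0 i, forall j, 0 < d2 0 j
      & B = diag_mx d1 *m A *m diag_mx d2].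

Definition balanced (a : 'cV[R]_n) (b : 'cV[R]_m) (c : 'cV[R]_n) B : Prop :=
  B *m a = b /\ B^T *m const_mx 1 = c.

End MatrixScaling.

Definition is_minimizer {R : realType} {T : Type} (D : set T) (f : T -> R)
    (x : T) : Prop :=
  D x /\ forall y, D y -> f x <= f y.

Section ModifiedAlgorithm.
Context {R : realType} {m n : nat}.
Local Notation E := ('cV[R]_m * 'cV[R]_n)%type.

(* The norm `|x| that the library puts on E is a sup norm; the algorithm uses
   the Euclidean structure of R^m x R^n, hence the explicit [dot] and [enorm].
   Both norms induce the same topology. *)
Definition dot (x y : E) : R :=
  \sum_i x.1 i 0 * y.1 i 0 + \sum_j x.2 j 0 * y.2 j 0.

Definition enorm (x : E) : R := Num.sqrt (dot x x).

(* When [S] is a linear subspace, each of the next two [xget] picks the unique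
   point with the stated property. *)
Definition orth_proj (S : set E) (x : E) : E :=
  xget 0 [set y | S y /\ forall z, S z -> dot (x - y) z = 0].

(* Gradient at x, in S, of the restriction of [f] to S (x is meant to lie
   in S, so that only values of [f] on S matter). *)
Definition gradient_on (S : set E) (f : E -> R) (x : E) : E :=
  xget 0 [set g | S g /\ forall w, S w -> 'D_w f x = dot g w].

Definition hyperplane (k : nat) (s : 'cV[R]_k) : set 'cV[R]_k :=
  [set x | s^T *m x = 0].

Variables (At : 'M[R]_(m, n)) (s1 : 'cV[R]_m) (s2 : 'cV[R]_n).

Definition ftilde (x : E) : R :=
  \sum_i \sum_j At i j * expR (x.1 i 0 + x.2 j 0).

Definition spaceU : set E := hyperplane s1 `*` hyperplane s2.

Definition V0 : set E :=
  [set x | spaceU x /\ forall i j, 0 < At i j -> x.1 i 0 + x.2 j 0 = 0].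

Definition V0perp : set E :=
  [set x | spaceU x /\ forall v, V0 v -> dot x v = 0].

Definition P0 : E -> E := orth_proj V0perp.

Definition W1 : set E := [set P0 (u, 0) | u in hyperplane s1].
Definition W2 : set E := [set P0 (0, v) | v in hyperplane s2].

Definition grad_along (W : set E) (x : E) : E :=
  orth_proj W (gradient_on V0perp ftilde x).

Definition row_update (x y : E) : Prop :=
  exists2 u, unique (is_minimizer (hyperplane s1) (fun u => ftilde (u, x.2))) u
    & y = P0 (u, x.2).

Definition col_update (x y : E) : Prop :=
  exists2 v, unique (is_minimizer (hyperplane s2) (fun v => ftilde (x.1, v))) v
    & y = P0 (x.1, v).

(* In case of a tie both updates are allowed. *)
Definition modified_step (x y : E) : Prop :=
     enorm (grad_along W2 x) <= enorm (grad_along W1 x) /\ row_update x y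
  \/ enorm (grad_along W1 x) <= enorm (grad_along W2 x) /\ col_update x y.

Definition modified_run (x0 : E) (x : nat -> E) : Prop :=
  x 0%N = x0 /\ forall k, modified_step (x k) (x k.+1).

Definition exp_scaling (x : E) : 'M[R]_(m, n) :=
  \matrix_(i, j) (expR (x.1 i 0 + x.2 j 0) * At i j).

End ModifiedAlgorithm.

(* Main.v *)
Require Import Defs.
From HB Require Import structures.
From mathcomp Require Import all_boot all_order all_algebra.
From mathcomp Require Import all_classical all_reals all_analysis.
From mathcomp Require Import ring lra.
Set Implicit Arguments.
Unset Strict Implicit.
Unset Printing Implicit Defensive.
Import Order.TTheory GRing.Theory Num.Theory.
Import numFieldNormedType.Exports.
Local Open Scope classical_set_scope.
Local Open Scope ring_scope.

(** Replacing A by A diag(a) reduces everything to a nonnegative matrix At with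
    prescribed row sums s1 and column sums s2 of equal total. Scalings of At
    are, up to a factor, the matrices M(u, v) with entries exp(u_i + v_j) At_ij,
    and the objective f is the sum of the entries of M. It is convex, its partial
    derivatives are the row and column sums of M, and so (u, v) minimises f in
    each block separately, within the hyperplanes of s1 and s2, exactly when the
    row sums of M are proportional to s1 and the column sums to s2. Such a
    point, taken in V0perp, is called critical; M divided by the common factor is
    then the balanced scaling. The balanced scaling is unique by monotonicity of
    exp ([scaling_unique]), and therefore so is the critical point of V0perp
    ([critical_unique]).

    A feasible matrix Ct makes f coercive on V0perp ([sublevel_bounded]): the
    Ct-weighted sum of u_i + v_j is zero on U, so upper bounds for these numbers
    on the support of At, which follow from a bound on f, entail lower bounds;
    and on V0perp these numbers determine the point. Every run thus stays in a
    compact set.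

    It remains to see that cluster points of a run are critical. A block update
    leaves the gradient along its block equal to zero. Since the next update is
    made along the larger gradient, the value of f after it is at most the
    minimum of f over either block through the current point
    ([modified_step_greedy]). As f decreases along the run, the value f(y) at a
    cluster point y bounds all these block minima from below, and this
    inequality passes to the limit: y minimises f in each block
    ([run_cluster_critical]). The critical point being unique, the run converges
    to it ([run_cvg]). Its existence needs no separate argument: the run started
    at zero produces it, and with it the balanced scaling of At. *)

(** * Orthogonal projections in the product of two Euclidean spaces *)

Section Dot.
Context {R : realType} {m n : nat}.
Local Notation E := ('cV[R]_m * 'cV[R]_n)%type.
Implicit Types (x y z : E) (S : set E).

Lemma dotC x y : dot x y = dot y x.
Proof.
by rewrite /dot; congr (_ + _); apply: eq_bigr => i _; rewrite mulrC.
Qed.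

Lemma dotDl k x y z : dot (k *: x + y) z = k * dot x z + dot y z.
Proof.
rewrite /dot mulrDr !mulr_sumr addrACA -!big_split /=.
by congr (_ + _); apply: eq_bigr => i _; rewrite !mxE; ring.
Qed.

Lemma dotDr k x y z : dot z (k *: x + y) = k * dot z x + dot z y.
Proof. by rewrite dotC dotDl !(dotC z). Qed.

Lemma dot0r x : dot x 0 = 0.
Proof. by have := dotDr 1 0 0 x; rewrite scale1r addr0; lra. Qed.

Lemma dot_inl (u : 'cV[R]_m) x : dot (u, 0) x = \sum_i u i 0 * x.1 i 0.
Proof. by rewrite /dot [X in _ + X]big1 ?addr0// => j _; rewrite mxE mul0r. Qed.

Lemma dot_inr (v : 'cV[R]_n) x : dot (0, v) x = \sum_j v j 0 * x.2 j 0.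
Proof. by rewrite /dot [X in X + _]big1 ?add0r// => i _; rewrite mxE mul0r. Qed.

Lemma dotBl x y z : dot (x - y) z = dot x z - dot y z.
Proof. by rewrite addrC -scaleN1r dotDl; ring. Qed.

Lemma dot_eq0 x : dot x x = 0 -> x = 0.
Proof.
have ge0 (k : nat) (u : 'cV[R]_k) : 0 <= \sum_i u i 0 * u i 0.
  by apply: sumr_ge0 => i _; rewrite -expr2 sqr_ge0.
have eq0 (k : nat) (u : 'cV[R]_k) : \sum_i u i 0 * u i 0 = 0 -> u = 0.
  move=> u0; apply/matrixP => i j; rewrite ord1 mxE.
  apply/eqP; rewrite -sqrf_eq0 expr2; apply/eqP.
  by apply: (psumr_eq0P _ u0) => // k' _; rewrite -expr2 sqr_ge0.
case: x => u v; rewrite /dot /= => h.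
have := ge0 _ u; have := ge0 _ v => hv hu.
by congr (_, _); apply: eq0; lra.
Qed.

Lemma enorm_le0 x y : enorm x <= enorm y -> y = 0 -> x = 0.
Proof.
move=> + y0; rewrite /enorm y0 dot0r sqrtr0 => h.
apply: dot_eq0; apply/le_anti/andP; split.
  by rewrite -sqrtr_eq0 eq_le h sqrtr_ge0.
by rewrite /dot addr_ge0//; apply: sumr_ge0 => i _; rewrite -expr2 sqr_ge0.
Qed.

Definition linear_subspace S :=
  S 0 /\ forall k x y, S x -> S y -> S (k *: x + y).

Lemma subspaceB S x y : linear_subspace S -> S x -> S y -> S (x - y).
Proof. by move=> [_ h] Sx Sy; rewrite addrC -scaleN1r; apply: h. Qed.

(** A set closed under linear combinations in a finite-dimensional space is the
    underlying set of a vspace: any vspace of maximal dimension inside it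
    exhausts it. This brings dimension counting and left inverses to bear on
    the subspaces of the algorithm, which are given as mere sets. *)
Lemma subspace_vspace S : linear_subspace S ->
  exists V : {vspace E}, forall x, S x <-> x \in V.
Proof.
move=> [S0 SD].
pose P d := `[< exists V : {vspace E},
  (forall x, x \in V -> S x) /\ \dim V = d >].
have P0 : P 0%N.
  apply/asboolP; exists 0%VS; split; last by rewrite dimv0.
  by move=> x; rewrite memv0 => /eqP ->.
have exP : exists d, P d by exists 0%N.
have Pbound d : P d -> (d <= \dim {: E})%N.
  by move=> /asboolP[V [_ <-]]; exact/dimvS/subvf.
have [d /asboolP[V [VS dimV]] dmax] := ex_maxnP exP Pbound.
exists V => x; split; last exact: VS.
move=> Sx; apply: contrapT => /negP xV.
have : P (\dim (V + <[x]>)).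
  apply/asboolP; exists (V + <[x]>)%VS; split=> // y.
  move=> /memv_addP[v vV [w /vlineP[k ->] ->]].
  by rewrite addrC; apply: SD => //; apply: VS.
move=> /dmax; apply/negP; rewrite -ltnNge -dimV.
have [le|//] := leqP (\dim (V + <[x]>)) (\dim V).
have /eqP e : (V == V + <[x]>)%VS by rewrite eqEdim addvSl.
move: xV; rewrite e; case/negP.
by apply: (subvP (addvSr _ _)); exact: memv_line.
Qed.

Definition orthogonal_to S : set E := [set x | forall z, S z -> dot x z = 0].

(** The orthogonal complement of V is the kernel of the dot products with a
    basis of V, so it has codimension at most dim V; as it meets V trivially,
    the two together span everything. *)
Lemma subspace_decomp S x : linear_subspace S ->
  exists y, S y /\ orthogonal_to S (x - y).
Proof.
move=> /subspace_vspace[V SV].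
pose e := vbasis V.
pose g (x : E) : 'rV[R]_(\dim V) := \row_i dot x e`_i.
have glin : linear g.
  by move=> k u v; apply/rowP => i; rewrite !mxE dotDl.
pose gl := GRing.isLinear.Build _ _ _ _ g glin.
pose G : {linear E -> 'rV[R]_(\dim V)} := HB.pack g gl.
pose W := lker (linfun G).
have WP y : reflect (forall z, z \in V -> dot y z = 0) (y \in W).
  rewrite memv_ker lfunE; apply: (iffP eqP) => [gy z zV|yV].
    rewrite (coord_vbasis zV) dotC.
    elim/big_rec: _ => [|i t _ IH]; first by rewrite dotC dot0r.
    rewrite dotDl IH addr0 dotC -/e.
    by have /rowP/(_ i) := gy; rewrite !mxE => ->; rewrite mulr0.
  apply/rowP => i; rewrite !mxE; apply: yV.
  by apply: vbasis_mem; rewrite mem_nth// size_tuple.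
have VW0 : (V :&: W)%VS = 0%VS.
  apply/eqP; rewrite -subv0; apply/subvP => y /memv_capP[yV /WP yW].
  by rewrite memv0; apply/eqP/dot_eq0/yW.
have VW : (V + W)%VS = fullv.
  apply/eqP; rewrite eqEdim subvf (dimv_disjoint_sum VW0).
  rewrite -(limg_ker_dim (linfun G) fullv) capfv addnC leq_add2r.
  by rewrite (leq_trans (dimvS (subvf _)))// dimvf /dim /= mul1n.
have : x \in (V + W)%VS by rewrite VW memvf.
move=> /memv_addP[y yV [w /WP wW ->]]; exists y; split; first exact/SV.
by move=> z /SV zV; rewrite addrC addKr; apply: wW.
Qed.

(** The value selected by [xget] in [orth_proj] is not the default one. *)
Lemma orth_projP S x : linear_subspace S ->
  S (orth_proj S x) /\ orthogonal_to S (x - orth_proj S x).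
Proof.
move=> /subspace_decomp - /(_ x)[y hy].
pose Q y := S y /\ forall z, S z -> dot (x - y) z = 0.
exact: (xgetPex 0 (ex_intro Q y hy)).
Qed.

Lemma orth_proj_unique S x y z : linear_subspace S ->
  S y -> orthogonal_to S (x - y) -> S z -> orthogonal_to S (x - z) -> y = z.
Proof.
move=> hS Sy oy Sz oz; apply/subr0_eq/dot_eq0.
have Syz := subspaceB hS Sy Sz.
have := oy _ Syz; have := oz _ Syz; rewrite !dotBl; lra.
Qed.

Lemma orth_projE S x y : linear_subspace S ->
  S y -> orthogonal_to S (x - y) -> orth_proj S x = y.
Proof.
move=> hS Sy oy; have [S1 o1] := orth_projP x hS.
exact: orth_proj_unique S1 o1 Sy oy.
Qed.

End Dot.

(** * Compactness and continuity *)

(** Used to recover a point of a subspace, linearly and hence with a bound,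
    from linear data that determine it. *)
Lemma left_inverse_on (K : fieldType) (aT rT : vectType K) (f : 'Hom(aT, rT))
    (V : {vspace aT}) : (forall x, x \in V -> f x = 0 -> x = 0) ->
  exists g : {linear rT -> aT}, forall x, x \in V -> g (f x) = x.
Proof.
move=> inj; pose h := (f \o linfun (vsval : subvs_of V -> aT))%VF.
have h0 : lker h == 0%VS.
  rewrite -subv0; apply/subvP => w; rewrite memv_ker memv0 comp_lfunE lfunE /=.
  move=> /eqP hw; apply/eqP/val_inj => /=.
  by rewrite (inj _ _ hw)//; exact: subvsP.
exists (vsval \o (h^-1)%VF) => x xV /=.
have -> : f x = h (vsproj V x) by rewrite comp_lfunE lfunE /= vsprojK.
by rewrite lker0_lfunK// vsprojK.
Qed.

Lemma linear_mx_bounded (R : realType) k l (V : normedModType R)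
    (g : {linear 'M[R]_(k, l) -> V}) :
  exists c, forall (y : 'M[R]_(k, l)) r,
    (forall i j, `|y i j| <= r) -> `|g y| <= r * c.
Proof.
exists (\sum_i \sum_j `|g (delta_mx i j)|) => y r yr.
rewrite {1}(matrix_sum_delta y) linear_sum.
rewrite (le_trans (ler_norm_sum _ _ _))// mulr_sumr ler_sum// => i _.
rewrite linear_sum (le_trans (ler_norm_sum _ _ _))// mulr_sumr ler_sum// => j _.
by rewrite linearZ normrZ ler_wpM2r.
Qed.

(** The only limiting argument needed to identify the cluster points of a run:
    conditions that are closed pass from a tail of the sequence to them. *)
Lemma cluster_seq_closed (T : topologicalType) (x : nat -> T) (S : set T) y k0 :
  closed S -> (forall k, (k0 <= k)%N -> S (x k)) ->
  cluster (x k @[k --> \oo]) y -> S y.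
Proof.
move=> cS xS; rewrite clusterE => /(_ S) yS; apply/cS/yS.
by exists k0 => // k /= /xS.
Qed.

Section Topology.
Context {R : realType} {m n : nat}.
Local Notation E := ('cV[R]_m * 'cV[R]_n)%type.

Lemma trmx_continuous k l : continuous (fun x : 'M[R]_(k, l) => x^T).
Proof.
move=> x A /= /(nbhs_ballP _ A)[e e0 eA].
apply/nbhs_ballP; exists e => //= y [_ xy]; apply: eA; split=> // i j.
by rewrite !mxE; exact: xy.
Qed.

(** Balls of the sup norm written in coordinates, so that their compactness
    reduces to that of products of segments. *)
Definition box (r : R) : set E :=
  [set x : E | (forall i, `|x.1 i 0| <= r) /\ (forall j, `|x.2 j 0| <= r)].

Lemma compact_box r : compact (box r).
Proof.
have cpt k : compact [set x : 'cV[R]_k | forall i, `|x i 0| <= r].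
  pose B := [set x : 'rV[R]_k | forall i, `[- r, r]%classic (x ord0 i)].
  have -> : [set x : 'cV[R]_k | forall i, `|x i 0| <= r] = trmx @` B.
    apply/seteqP; split=> [x xr|_ [y yB <-] i].
      exists x^T; last exact: trmxK.
      by move=> i; rewrite /= in_itv/= mxE -ler_norml; exact: xr.
    by have := yB i; rewrite /= in_itv/= -ler_norml mxE.
  apply: continuous_compact; first exact/continuous_subspaceT/trmx_continuous.
  apply: (@rV_compact _ _ (fun=> `[- r, r]%classic)) => i.
  exact: segment_compact.
exact: compact_setX (cpt m) (cpt n).
Qed.

Lemma box_norm (x : E) : box `|x| x.
Proof.
have h k (u : 'cV[R]_k) i : `|u i 0| <= `|u|.
  rewrite [leRHS]/Num.norm /= mx_normrE; apply/bigmax_geP; right => /=.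
  by exists (i, 0).
by rewrite prod_normE; split=> i; rewrite le_max h ?orbT.
Qed.

Lemma box_le r r' : r <= r' -> box r `<=` box r'.
Proof. by move=> rr x [x1 x2]; split=> i; rewrite (le_trans _ rr). Qed.

Lemma nbhs_box r x : box r x -> nbhs x (box (r + 1)).
Proof.
move=> [x1 x2]; apply/nbhs_ballP; exists 1 => //= y; rewrite -ball_normE /=.
rewrite -opprB normrN => xy.
have [y1 y2] := box_norm (y - x).
split=> i; [have := y1 i; have := x1 i | have := y2 i; have := x2 i];
  rewrite !mxE => a b.
- rewrite -[y.1 i 0](subrKC (x.1 i 0)) (le_trans (ler_normD _ _))// lerD//.
  exact/ltW/(le_lt_trans b).
- rewrite -[y.2 i 0](subrKC (x.2 i 0)) (le_trans (ler_normD _ _))// lerD//.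
  exact/ltW/(le_lt_trans b).
Qed.

Lemma coord1_continuous i : continuous (fun x : E => x.1 i 0).
Proof.
move=> x; apply: (@continuous_comp _ _ _ fst (fun u : 'cV[R]_m => u i 0)).
  exact: cvg_fst.
exact: coord_continuous.
Qed.

Lemma coord2_continuous j : continuous (fun x : E => x.2 j 0).
Proof.
move=> x; apply: (@continuous_comp _ _ _ snd (fun u : 'cV[R]_n => u j 0)).
  exact: cvg_snd.
exact: coord_continuous.
Qed.

Lemma continuous_closed_le (f g : E -> R) :
  continuous f -> continuous g -> closed [set x | f x <= g x].
Proof.
move=> cf cg.
have -> : [set x | f x <= g x] = (fun x => f x - g x) @^-1` [set y | y <= 0].
  by apply/seteqP; split=> x /=; rewrite subr_le0.
apply: preimage_closed; last exact: closed_le.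
by move=> x _; apply: cvgB; [exact: cf|exact: cg].
Qed.

Lemma continuous_sum k (f : 'I_k -> E -> R) :
  (forall i, continuous (f i)) -> continuous (fun x => \sum_i f i x).
Proof.
by move=> cf x; apply: (cvg_big add_continuous) => i _; exact: cf.
Qed.

Lemma continuous_ftilde_comp (At : 'M[R]_(m, n)) (f : E -> E) :
  (forall i, continuous (fun x => (f x).1 i 0)) ->
  (forall j, continuous (fun x => (f x).2 j 0)) ->
  continuous (fun x => ftilde At (f x)).
Proof.
move=> cf cg; apply: continuous_sum => i; apply: continuous_sum => j x.
apply: cvgMr => /=.
apply: (@continuous_comp _ _ _ (fun x => (f x).1 i 0 + (f x).2 j 0) expR);
  last exact: continuous_expR.
by apply: cvgD; [exact: cf|exact: cg].
Qed.

Lemma continuous_dotr (v : E) : continuous (fun x => dot x v).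
Proof.
move=> x; apply: cvgD.
  by apply: continuous_sum => i y; apply: cvgMl; exact: coord1_continuous.
by apply: continuous_sum => i y; apply: cvgMl; exact: coord2_continuous.
Qed.

End Topology.

(** * Exponential sums on a hyperplane *)

Section Exp.
Context {R : realType}.

Lemma hyperplaneP k (s x : 'cV[R]_k) :
  hyperplane s x <-> \sum_i s i 0 * x i 0 = 0.
Proof.
have E : (s^T *m x) 0 0 = \sum_i s i 0 * x i 0.
  by rewrite mxE; apply: eq_bigr => i _; rewrite mxE.
split; rewrite /hyperplane /=; first by move=> h; rewrite -E h mxE.
by move=> h; apply/matrixP => i j; rewrite !ord1 E h mxE.
Qed.

Lemma expR_tangent (s t : R) : expR s * (1 + (t - s)) <= expR t.
Proof.
rewrite -[in leRHS](subrKC s t) expRD ler_wpM2l ?expR_ge0//.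
by apply: expR_ge1Dx.
Qed.

Lemma expR_tangent_lt (s t : R) : t != s -> expR s * (1 + (t - s)) < expR t.
Proof.
move=> ts; rewrite -[in ltRHS](subrKC s t) expRD ltr_pM2l ?expR_gt0//.
by apply: expR_gt1Dx; rewrite subr_eq0.
Qed.

(** The summands are convex, and at u the weighted sum has a derivative that is
    proportional to s, hence vanishes along the hyperplane; summing the tangent
    inequalities of [expR] at u gives minimality, their strictness gives
    uniqueness. *)
Lemma weighted_exp_min k (s : 'cV[R]_k) (r : 'I_k -> R) (u : 'cV[R]_k) (l : R) :
  (forall i, 0 < s i 0) -> (forall i, 0 < r i) -> hyperplane s u ->
  (forall i, r i * expR (u i 0) = l * s i 0) ->
  unique (is_minimizer (hyperplane s) (fun u => \sum_i r i * expR (u i 0))) u.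
Proof.
move=> s0 r0 /hyperplaneP su E.
have tan (v : 'cV[R]_k) : hyperplane s v ->
    \sum_i r i * (expR (u i 0) * (1 + (v i 0 - u i 0))) =
    \sum_i r i * expR (u i 0).
  move=> /hyperplaneP sv; transitivity (\sum_i (r i * expR (u i 0) +
     (l * (s i 0 * v i 0) - l * (s i 0 * u i 0)))).
    by apply: eq_bigr => i _; rewrite mulrA mulrDr mulr1 {2}E; ring.
  by rewrite big_split/= sumrB -!mulr_sumr su sv !mulr0 subr0 addr0.
have min : is_minimizer (hyperplane s) (fun u => \sum_i r i * expR (u i 0)) u.
  split=> [|v Hv]; first exact/hyperplaneP.
  rewrite -(tan v)//; apply: ler_sum => i _.
  by rewrite ler_wpM2l ?(ltW (r0 i))// expR_tangent.
split=> // v [Hv vmin]; apply: contrapT => uv.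
have [i uvi] : exists i, v i 0 != u i 0.
  apply: contrapT => h; apply: uv; apply/matrixP => i j; rewrite ord1.
  by apply: contrapT => ne; apply: h; exists i; rewrite eq_sym; apply/eqP.
have := vmin u min.1; apply/negP; rewrite -ltNge -(tan v)//.
rewrite (bigD1 i)//= [ltRHS](bigD1 i)//= ltr_leD//.
  by rewrite ltr_pM2l ?r0// expR_tangent_lt.
by apply: ler_sum => j _; rewrite ler_wpM2l ?(ltW (r0 j))// expR_tangent.
Qed.

(** The proportionality condition forces u i = ln l - ln (r i / s i), and
    membership in the hyperplane then determines ln l as the s-weighted mean
    of the ln (r i / s i). *)
Lemma weighted_exp_min_exists k (s : 'cV[R]_k) (r : 'I_k -> R) : (0 < k)%N ->
  (forall i, 0 < s i 0) -> (forall i, 0 < r i) ->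
  exists u l,
    [/\ 0 < l, hyperplane s u & forall i, r i * expR (u i 0) = l * s i 0].
Proof.
move=> k0 s0 r0; pose S := \sum_i s i 0.
have S0 : 0 < S.
  rewrite /S (bigD1 (Ordinal k0))//= ltr_pwDl// sumr_ge0// => i _.
  exact: ltW.
pose lnl := (\sum_i s i 0 * ln (r i / s i 0)) / S.
exists (\col_i (lnl - ln (r i / s i 0))), (expR lnl); split.
- exact: expR_gt0.
- apply/hyperplaneP.
  under eq_bigr do rewrite mxE mulrBr.
  by rewrite sumrB -mulr_suml -/S /lnl mulrCA divff ?gt_eqF// mulr1 subrr.
- move=> i; rewrite mxE expRD expRN lnK; last by rewrite posrE divr_gt0.
  by field; rewrite !gt_eqF.
Qed.

End Exp.

(** * Marginals of the scaled matrix and the gradient *)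

Section Sums.
Context {R : realType} {m n : nat}.
Local Notation E := ('cV[R]_m * 'cV[R]_n)%type.
Implicit Types (x y : E) (A B : 'M[R]_(m, n)).

Definition rowsum B i := \sum_j B i j.
Definition colsum B j := \sum_i B i j.

Lemma balanced1P (b : 'cV[R]_m) (c : 'cV[R]_n) B :
  balanced (const_mx 1) b c B <->
  (forall i, rowsum B i = b i 0) /\ (forall j, colsum B j = c j 0).
Proof.
have rE i : (B *m (const_mx 1 : 'cV[R]_n)) i 0 = rowsum B i.
  by rewrite mxE; apply: eq_bigr => j _; rewrite mxE mulr1.
have cE j : (B^T *m (const_mx 1 : 'cV[R]_m)) j 0 = colsum B j.
  by rewrite mxE; apply: eq_bigr => i _; rewrite !mxE mulr1.
split=> [[Bb Bc]|[hb hc]].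
  by split=> [i|j]; rewrite -?rE -?cE ?Bb ?Bc.
split; apply/matrixP => i j; rewrite !ord1 ?rE ?cE ?hb ?hc//.
Qed.

Lemma rowsumZ l B i : rowsum (l *: B) i = l * rowsum B i.
Proof. by rewrite /rowsum mulr_sumr; apply: eq_bigr => j _; rewrite mxE. Qed.

Lemma colsumZ l B j : colsum (l *: B) j = l * colsum B j.
Proof. by rewrite /colsum mulr_sumr; apply: eq_bigr => i _; rewrite mxE. Qed.

Lemma sum_rowsum B : \sum_i rowsum B i = \sum_j colsum B j.
Proof. exact: exchange_big. Qed.

(** A matrix acts on the pairs u_i + v_j only through its marginals. Two
    matrices with the same marginals thus have the same pairing, and a matrix
    with marginals s1 and s2 pairs to zero with every point of U. *)
Lemma pairing_marginals B x :
  \sum_i \sum_j B i j * (x.1 i 0 + x.2 j 0) =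
  \sum_i rowsum B i * x.1 i 0 + \sum_j colsum B j * x.2 j 0.
Proof.
transitivity (\sum_i \sum_j B i j * x.1 i 0 + \sum_i \sum_j B i j * x.2 j 0).
  rewrite -big_split/=; apply: eq_bigr => i _; rewrite -big_split/=.
  by apply: eq_bigr => j _; rewrite mulrDr.
congr (_ + _); last rewrite exchange_big.
all: by apply: eq_bigr => k _; rewrite mulr_suml.
Qed.

Variable At : 'M[R]_(m, n).
Local Notation M := (exp_scaling At).

Lemma ftilde_rowsum x : ftilde At x = \sum_i rowsum (M x) i.
Proof.
by apply: eq_bigr => i _; apply: eq_bigr => j _; rewrite mxE mulrC.
Qed.

(** For fixed v the objective is the exponential sum in u with these weights,
    which reduces row updates to [weighted_exp_min]. *)
Definition rowweight (v : 'cV[R]_n) i := \sum_j At i j * expR (v j 0).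
Definition colweight (u : 'cV[R]_m) j := \sum_i At i j * expR (u i 0).

Lemma rowsum_exp_scaling x i :
  rowsum (M x) i = rowweight x.2 i * expR (x.1 i 0).
Proof.
rewrite /rowsum /rowweight mulr_suml; apply: eq_bigr => j _.
by rewrite mxE expRD; ring.
Qed.

Lemma colsum_exp_scaling x j :
  colsum (M x) j = colweight x.1 j * expR (x.2 j 0).
Proof.
rewrite /colsum /colweight mulr_suml; apply: eq_bigr => i _.
by rewrite mxE expRD; ring.
Qed.

Lemma ftilde_rowE v :
  (fun u => ftilde At (u, v)) = fun u => \sum_i rowweight v i * expR (u i 0).
Proof.
apply/funext => u; rewrite ftilde_rowsum.
by apply: eq_bigr => i _; rewrite rowsum_exp_scaling.
Qed.

Lemma ftilde_colE u :
  (fun v => ftilde At (u, v)) = fun v => \sum_j colweight u j * expR (v j 0).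
Proof.
apply/funext => v; rewrite ftilde_rowsum sum_rowsum.
by apply: eq_bigr => j _; rewrite colsum_exp_scaling.
Qed.

Definition full_gradient x : E :=
  (\col_i rowsum (M x) i, \col_j colsum (M x) j).
Local Notation G := full_gradient.

Lemma dot_full_gradient x w :
  dot (G x) w = \sum_i \sum_j M x i j * (w.1 i 0 + w.2 j 0).
Proof.
rewrite pairing_marginals /dot /=.
by congr (_ + _); apply: eq_bigr => i _; rewrite mxE.
Qed.

(** Reduces a directional derivative to the derivative of a function of one
    real variable, for which the derivation rules of [expR] are available. *)
Lemma is_derive_line (V : normedModType R) (F : V -> R) (x w : V) (d : R) :
  is_derive (0 : R) 1 (fun t => F (t *: w + x)) d -> is_derive x w F d.
Proof.
move=> [hd hv].
have E :
    (fun h => h^-1 *: (((fun t => F (t *: w + x)) \o shift 0) (h *: (1 : R))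
                       - F (0 *: w + x))) =
    (fun h => h^-1 *: ((F \o shift x) (h *: w) - F x)).
  by apply/funext => h /=; rewrite scale0r add0r addr0 [h *: 1]mulr1.
by move: hd hv; rewrite /derivable /derive E.
Qed.

Lemma is_derive_ftilde x w : is_derive x w (ftilde At) (dot (G x) w).
Proof.
rewrite dot_full_gradient.
have term i j : is_derive x w (fun x : E => At i j * expR (x.1 i 0 + x.2 j 0))
    (M x i j * (w.1 i 0 + w.2 j 0)).
  apply: is_derive_line => /=.
  have -> :
      (fun t : R =>
         At i j * expR ((t *: w + x).1 i 0 + (t *: w + x).2 j 0)) =
      (fun t => At i j * expR (t * (w.1 i 0 + w.2 j 0) + (x.1 i 0 + x.2 j 0))).
    by apply/funext => t; rewrite !mxE; congr (_ * expR _); ring.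
  apply: is_derive_eq.
  by rewrite mul0r add0r mxE /GRing.scale/=; ring.
have -> : ftilde At =
    \sum_i \sum_j (fun x : E => At i j * expR (x.1 i 0 + x.2 j 0)).
  apply/funext => y; rewrite fct_sumE; apply: eq_bigr => i _.
  by rewrite fct_sumE.
by apply: is_derive_sum => i; apply: is_derive_sum => j.
Qed.

End Sums.

(** Write B i j = B' i j * exp t with t = p i + q j. The pairing of B - B' with
    (p, q) vanishes because the marginals agree, but it is a sum of the terms
    B' i j * (exp t - 1) * t, none of which is negative; so each is zero. *)
Lemma scaling_unique (R : realType) m n (A B B' : 'M[R]_(m, n)) :
  nonneg_mx A -> is_scaling A B -> is_scaling A B' ->
  (forall i, rowsum B i = rowsum B' i) ->
  (forall j, colsum B j = colsum B' j) ->
  B = B'.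
Proof.
move=> A0 [d1 [d2 [d1_gt0 d2_gt0 EB]]] [e1 [e2 [e1_gt0 e2_gt0 EB']]] hr hc.
have mxE3 (f1 : 'rV[R]_m) (f2 : 'rV[R]_n) i j :
    (diag_mx f1 *m A *m diag_mx f2) i j = f1 0 i * A i j * f2 0 j.
  by rewrite mul_mx_diag mul_diag_mx !mxE.
pose x : 'cV[R]_m * 'cV[R]_n :=
  (\col_i (ln (d1 0 i) - ln (e1 0 i)), \col_j (ln (d2 0 j) - ln (e2 0 j))).
pose t i j := x.1 i 0 + x.2 j 0.
have BE i j : B i j = B' i j * expR (t i j).
  rewrite EB EB' !mxE3 /t !mxE !expRD !expRN !lnK ?posrE//.
  by field; rewrite !gt_eqF.
have B'0 i j : 0 <= B' i j by rewrite EB' mxE3 !mulr_ge0// ltW.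
have term_ge0 i j : 0 <= (B i j - B' i j) * t i j.
  have -> : (B i j - B' i j) * t i j = B' i j * ((expR (t i j) - 1) * t i j).
    by rewrite BE; ring.
  rewrite mulr_ge0//; have [t0|/ltW t0] := leP 0 (t i j).
    by rewrite mulr_ge0// subr_ge0 -expR0 ler_expR.
  by rewrite mulr_le0// subr_le0 -expR0 ler_expR.
have sum0 : \sum_i \sum_j (B i j - B' i j) * t i j = 0.
  transitivity (\sum_i \sum_j B i j * t i j - \sum_i \sum_j B' i j * t i j).
    rewrite -sumrB; apply: eq_bigr => i _; rewrite -sumrB.
    by apply: eq_bigr => j _; rewrite mulrBl.
  rewrite !pairing_marginals; under eq_bigr do rewrite hr.
  by under [X in _ + X - _]eq_bigr do rewrite hc; rewrite subrr.
apply/matrixP => i j.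
have row0 : \sum_j (B i j - B' i j) * t i j = 0.
  by apply: (psumr_eq0P _ sum0) => // k _; apply: sumr_ge0.
have /eqP : (B i j - B' i j) * t i j = 0 by apply: (psumr_eq0P _ row0).
rewrite mulf_eq0 subr_eq0 => /orP[/eqP //|/eqP t0].
by rewrite BE t0 expR0 mulr1.
Qed.

(** * The subspaces of the algorithm and block stationarity *)

Section Algorithm.
Context {R : realType} {m n : nat}.
Local Notation E := ('cV[R]_m * 'cV[R]_n)%type.
Variables (At : 'M[R]_(m, n)) (s1 : 'cV[R]_m) (s2 : 'cV[R]_n).
Implicit Types (x y : E) (S W : set E).
Local Notation M := (exp_scaling At).
Local Notation G := (full_gradient At).
Local Notation U := (spaceU s1 s2).
Local Notation V0 := (V0 At s1 s2).
Local Notation V0perp := (V0perp At s1 s2).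
Local Notation P0 := (P0 At s1 s2).
Local Notation W1 := (W1 At s1 s2).
Local Notation W2 := (W2 At s1 s2).

Lemma hyperplane0 k (s : 'cV[R]_k) : hyperplane s 0.
Proof. by rewrite /hyperplane /= mulmx0. Qed.

Lemma hyperplaneD k (s u v : 'cV[R]_k) l :
  hyperplane s u -> hyperplane s v -> hyperplane s (l *: u + v).
Proof.
by rewrite /hyperplane /= mulmxDr -scalemxAr => -> ->; rewrite scaler0 addr0.
Qed.

Lemma subspace_spaceU : linear_subspace U.
Proof.
split; first by split; [exact: (hyperplane0 s1)|exact: (hyperplane0 s2)].
by move=> k x y [? ?] [? ?]; split; exact: hyperplaneD.
Qed.

Lemma subspace_V0 : linear_subspace V0.
Proof.
split.
  by split; [exact: subspace_spaceU.1|move=> i j _; rewrite !mxE addr0].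
move=> k x y [Ux Vx] [Uy Vy]; split; first exact: subspace_spaceU.2.
move=> i j Aij; rewrite !mxE addrACA -mulrDr (Vx i j Aij) (Vy i j Aij).
by rewrite mulr0 addr0.
Qed.

Lemma subspace_V0perp : linear_subspace V0perp.
Proof.
split.
  by split; [exact: subspace_spaceU.1|move=> v _; rewrite dotC dot0r].
move=> k x y [Ux Vx] [Uy Vy]; split; first exact: subspace_spaceU.2.
by move=> v V0v; rewrite dotDl Vx// Vy// mulr0 addr0.
Qed.

Lemma P0_V0perp x : V0perp (P0 x).
Proof. by have [] := orth_projP x subspace_V0perp. Qed.

Lemma P0E x y : U x -> V0perp y -> V0 (x - y) -> P0 x = y.
Proof.
move=> Ux Py Vxy; apply: orth_projE => //; first exact: subspace_V0perp.
by move=> z [_ hz]; rewrite dotC hz.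
Qed.

(** Inside U the subspaces V0 and V0perp are complementary: subtracting from x
    its projection to V0 lands in V0perp and has the properties of P0 x. *)
Lemma P0_sub x : U x -> V0 (x - P0 x).
Proof.
move=> Ux; have [V0y oy] := orth_projP x subspace_V0.
set y := orth_proj _ x in V0y oy.
rewrite (@P0E x (x - y))//; first by rewrite opprB addrC subrK.
  by split=> //; exact: (subspaceB subspace_spaceU Ux V0y.1).
by rewrite opprB addrC subrK.
Qed.

Lemma V0_V0perp x : V0 x -> V0perp x -> x = 0.
Proof. by move=> Vx [_ /(_ x Vx)] /dot_eq0. Qed.

Lemma P0_linear k x y : U x -> U y -> P0 (k *: x + y) = k *: P0 x + P0 y.
Proof.
move=> Ux Uy; apply: P0E.
- exact: subspace_spaceU.2.
- by apply: subspace_V0perp.2; exact: P0_V0perp.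
- have -> : k *: x + y - (k *: P0 x + P0 y) = k *: (x - P0 x) + (y - P0 y).
    by rewrite scalerBr opprD addrACA.
  by apply: subspace_V0.2; exact: P0_sub.
Qed.

Lemma spaceU_inl u : hyperplane s1 u -> U (u, 0).
Proof. by move=> Hu; split=> //; exact: hyperplane0. Qed.

Lemma spaceU_inr v : hyperplane s2 v -> U (0, v).
Proof. by move=> Hv; split=> //; exact: hyperplane0. Qed.

Lemma P0_0 : P0 0 = 0.
Proof.
apply: P0E; rewrite ?subrr.
- exact: subspace_spaceU.1.
- exact: subspace_V0perp.1.
- exact: subspace_V0.1.
Qed.

Lemma subspace_W1 : linear_subspace W1.
Proof.
split; first by exists 0; [exact: hyperplane0|exact: P0_0].
move=> k _ _ [u Hu <-] [v Hv <-]; exists (k *: u + v); first exact: hyperplaneD.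
rewrite -P0_linear; [|exact: spaceU_inl..].
by congr (P0 (_, _)); rewrite /= scaler0 addr0.
Qed.

Lemma subspace_W2 : linear_subspace W2.
Proof.
split; first by exists 0; [exact: hyperplane0|exact: P0_0].
move=> k _ _ [u Hu <-] [v Hv <-]; exists (k *: u + v); first exact: hyperplaneD.
rewrite -P0_linear; [|exact: spaceU_inr..].
by congr (P0 (_, _)); rewrite /= scaler0 addr0.
Qed.

Lemma closed_V0perp : closed V0perp.
Proof.
have closed_dot (v : E) : closed [set x | dot x v = 0].
  have -> : [set x | dot x v = 0] = (fun x => dot x v) @^-1` [set 0].
    by [].
  apply: preimage_closed; last exact: closed_eq.
  by move=> x _; exact: continuous_dotr.
have -> : V0perp =
    [set x | dot x (s1, 0) = 0] `&` [set x | dot x (0, s2) = 0] `&`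
    \bigcap_(v in V0) [set x | dot x v = 0].
  apply/seteqP; split=> x /=; rewrite !(dotC x (_, _)) dot_inl dot_inr.
    by move=> [[/hyperplaneP h1 /hyperplaneP h2] h].
  by move=> [[h1 h2] h]; split; [split; exact/hyperplaneP|exact: h].
apply: closedI; first by apply: closedI; exact: closed_dot.
by apply: closed_bigI => v _; exact: closed_dot.
Qed.

Hypothesis At_ge0 : nonneg_mx At.

(** Displacements in V0 do not move u_i + v_j where the matrix is positive, so
    projecting by P0 changes neither the scaled matrix nor the objective. *)
Lemma exp_scaling_congr x y : V0 (x - y) -> M x = M y.
Proof.
move=> [_ Vxy]; apply/matrixP => i j; rewrite !mxE.
have [A0|] := eqVneq (At i j) 0; first by rewrite A0 !mulr0.
rewrite neq_lt ltNge At_ge0/= => /Vxy /=; rewrite !mxE => h.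
by congr (expR _ * _); lra.
Qed.

Lemma exp_scaling_P0 x : U x -> M (P0 x) = M x.
Proof. by move=> Ux; symmetry; apply: exp_scaling_congr; exact: P0_sub. Qed.

Lemma full_gradient_V0 x d : V0 d -> dot (G x) d = 0.
Proof.
move=> [_ Vd]; rewrite dot_full_gradient big1// => i _; rewrite big1// => j _.
have [A0|] := eqVneq (At i j) 0; first by rewrite mxE A0 mulr0 mul0r.
by rewrite neq_lt ltNge At_ge0/= => /Vd ->; rewrite mulr0.
Qed.

(** Only the directions of S are tested, so the gradient along S is the
    projection of the gradient in the whole space. *)
Lemma gradient_onE S x : linear_subspace S ->
  gradient_on S (ftilde At) x = orth_proj S (G x).
Proof.
move=> hS; have D w : 'D_w (ftilde At) x = dot (G x) w.
  exact: (@derive_val _ _ _ _ _ _ _ (is_derive_ftilde At x w)).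
rewrite /gradient_on; set P := (X in xget _ X).
have [So oo] := orth_projP (G x) hS.
have : P (xget 0 P).
  apply: (xgetPex 0); exists (orth_proj S (G x)); split=> // w Sw.
  by rewrite D; have := oo _ Sw; rewrite dotBl; lra.
move=> [Sg og]; apply/esym/orth_projE => // w Sw.
by rewrite dotBl -D og// subrr.
Qed.

Lemma grad_along_eq0 W x : linear_subspace W -> W `<=` V0perp ->
  grad_along At s1 s2 W x = 0 <-> orthogonal_to W (G x).
Proof.
move=> hW WV; rewrite /grad_along gradient_onE; last exact: subspace_V0perp.
have [_ og] := orth_projP (G x) subspace_V0perp.
set g := orth_proj V0perp (G x) in og *.
have gG w : W w -> dot g w = dot (G x) w.
  by move=> Ww; have := og _ (WV _ Ww); rewrite dotBl; lra.
split=> [p0 w Ww|oG].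
  by have [_ /(_ _ Ww)] := orth_projP g hW; rewrite p0 subr0 gG.
apply: orth_projE => //; first exact: hW.1.
by move=> w Ww; rewrite subr0 gG// oG.
Qed.

(** Stationarity of the objective in the row block, constrained to the
    hyperplane of s1; it says that the row sums are proportional to s1. *)
Definition row_stationary x :=
  forall u, hyperplane s1 u -> \sum_i rowsum (M x) i * u i 0 = 0.
Definition col_stationary x :=
  forall v, hyperplane s2 v -> \sum_j colsum (M x) j * v j 0 = 0.

(** The full gradient is orthogonal to V0; this makes the derivatives along W1
    and W2 equal to those along the unprojected blocks. *)
Lemma dot_full_gradient_P0 x y : U y -> dot (G x) (P0 y) = dot (G x) y.
Proof.
move=> Uy; have := full_gradient_V0 x (P0_sub Uy).
by rewrite dotC dotBl !(dotC _ (G x)); lra.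
Qed.

Lemma grad_along_W1_eq0 x : grad_along At s1 s2 W1 x = 0 <-> row_stationary x.
Proof.
have dE u : hyperplane s1 u ->
    dot (G x) (P0 (u, 0)) = \sum_i rowsum (M x) i * u i 0.
  move=> Hu; rewrite dot_full_gradient_P0; last exact: spaceU_inl.
  by rewrite dotC dot_inl; apply: eq_bigr => i _; rewrite mxE mulrC.
rewrite grad_along_eq0; first last.
- by move=> _ [u _ <-]; exact: P0_V0perp.
- exact: subspace_W1.
split=> [h u Hu|h _ [u Hu <-]]; last by rewrite dE// h.
by rewrite -dE// h//; exists u.
Qed.

Lemma grad_along_W2_eq0 x : grad_along At s1 s2 W2 x = 0 <-> col_stationary x.
Proof.
have dE v : hyperplane s2 v ->
    dot (G x) (P0 (0, v)) = \sum_j colsum (M x) j * v j 0.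
  move=> Hv; rewrite dot_full_gradient_P0; last exact: spaceU_inr.
  by rewrite dotC dot_inr; apply: eq_bigr => i _; rewrite mxE mulrC.
rewrite grad_along_eq0; first last.
- by move=> _ [u _ <-]; exact: P0_V0perp.
- exact: subspace_W2.
split=> [h u Hu|h _ [u Hu <-]]; last by rewrite dE// h.
by rewrite -dE// h//; exists u.
Qed.

(** Convexity of the objective in u alone. *)
Lemma row_stationary_min x u : row_stationary x -> hyperplane s1 x.1 ->
  hyperplane s1 u -> ftilde At x <= ftilde At (u, x.2).
Proof.
move=> st Hx Hu.
have := st _ (hyperplaneD (-1) Hx Hu).
rewrite !ftilde_rowsum => st0.
rewrite -[leLHS]addr0 -[X in _ + X]st0 -big_split /=; apply: ler_sum => i _.
rewrite !rowsum_exp_scaling /= -mulrA -mulrDr ler_wpM2l//.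
  by apply: sumr_ge0 => j _; rewrite mulr_ge0// expR_ge0.
rewrite (le_trans _ (expR_tangent (x.1 i 0) _))// !mxE le_eqVlt.
by apply/orP; left; apply/eqP; ring.
Qed.

Lemma col_stationary_min x v : col_stationary x -> hyperplane s2 x.2 ->
  hyperplane s2 v -> ftilde At x <= ftilde At (x.1, v).
Proof.
move=> st Hx Hv.
have := st _ (hyperplaneD (-1) Hx Hv).
rewrite !ftilde_rowsum !sum_rowsum => st0.
rewrite -[leLHS]addr0 -[X in _ + X]st0 -big_split /=; apply: ler_sum => i _.
rewrite !colsum_exp_scaling /= -mulrA -mulrDr ler_wpM2l//.
  by apply: sumr_ge0 => j _; rewrite mulr_ge0// expR_ge0.
rewrite (le_trans _ (expR_tangent (x.2 i 0) _))// !mxE le_eqVlt.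
by apply/orP; left; apply/eqP; ring.
Qed.

End Algorithm.

(** * Convergence in the presence of a feasible matrix *)

Section Feasible.
Context {R : realType} {m n : nat}.
Local Notation E := ('cV[R]_m * 'cV[R]_n)%type.
Variables (At Ct : 'M[R]_(m, n)) (s1 : 'cV[R]_m) (s2 : 'cV[R]_n).
Hypotheses (m_gt0 : (0 < m)%N) (n_gt0 : (0 < n)%N).
Hypotheses (s1_gt0 : forall i, 0 < s1 i 0) (s2_gt0 : forall j, 0 < s2 j 0).
Hypotheses (At_ge0 : nonneg_mx At) (Ct_ge0 : nonneg_mx Ct).
Hypothesis CtAt : same_zero_pattern Ct At.
Hypothesis Ct_row : forall i, rowsum Ct i = s1 i 0.
Hypothesis Ct_col : forall j, colsum Ct j = s2 j 0.
Implicit Types (x y : E).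
Local Notation M := (exp_scaling At).
Local Notation U := (spaceU s1 s2).
Local Notation V0 := (V0 At s1 s2).
Local Notation V0perp := (V0perp At s1 s2).
Local Notation P0 := (P0 At s1 s2).

Lemma Ct_gt0 i j : (0 < Ct i j) = (0 < At i j).
Proof.
rewrite !lt_neqAle Ct_ge0 At_ge0 !andbT !(eq_sym 0); congr (~~ _).
by apply/eqP/eqP => /CtAt.
Qed.

(** Feasibility excludes zero rows, as s1 is positive. *)
Lemma rowsum_has_pos i : exists j, 0 < At i j.
Proof.
apply: contrapT => h; have := s1_gt0 i.
rewrite -Ct_row /rowsum big1 ?ltxx// => j _.
apply/le_anti; rewrite Ct_ge0 andbT leNgt Ct_gt0.
by apply/negP => Aij; apply: h; exists j.
Qed.

Lemma colsum_has_pos j : exists i, 0 < At i j.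
Proof.
apply: contrapT => h; have := s2_gt0 j.
rewrite -Ct_col /colsum big1 ?ltxx// => i _.
apply/le_anti; rewrite Ct_ge0 andbT leNgt Ct_gt0.
by apply/negP => Aij; apply: h; exists i.
Qed.

Lemma rowweight_gt0 v i : 0 < rowweight At v i.
Proof.
have [j Aij] := rowsum_has_pos i.
rewrite /rowweight (bigD1 j)//= ltr_pwDl ?mulr_gt0 ?expR_gt0//.
by apply: sumr_ge0 => k _; rewrite mulr_ge0// expR_ge0.
Qed.

Lemma colweight_gt0 u j : 0 < colweight At u j.
Proof.
have [i Aij] := colsum_has_pos j.
rewrite /colweight (bigD1 i)//= ltr_pwDl ?mulr_gt0 ?expR_gt0//.
by apply: sumr_ge0 => k _; rewrite mulr_ge0// expR_ge0.
Qed.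

Lemma row_minimizer v : exists u l,
  [/\ 0 < l, unique (is_minimizer (hyperplane s1) (fun u => ftilde At (u, v))) u
    & forall i, rowsum (M (u, v)) i = l * s1 i 0].
Proof.
have [u [l [l0 Hu E]]] :=
  weighted_exp_min_exists m_gt0 s1_gt0 (rowweight_gt0 v).
exists u, l; split=> //; last by move=> i; rewrite rowsum_exp_scaling E.
by rewrite ftilde_rowE; exact: (weighted_exp_min s1_gt0 (rowweight_gt0 v) Hu E).
Qed.

Lemma col_minimizer u : exists v l,
  [/\ 0 < l, unique (is_minimizer (hyperplane s2) (fun v => ftilde At (u, v))) v
    & forall j, colsum (M (u, v)) j = l * s2 j 0].
Proof.
have [v [l [l0 Hu E]]] :=
  weighted_exp_min_exists n_gt0 s2_gt0 (colweight_gt0 u).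
exists v, l; split=> //; last by move=> i; rewrite colsum_exp_scaling E.
by rewrite ftilde_colE; exact: (weighted_exp_min s2_gt0 (colweight_gt0 u) Hu E).
Qed.

Lemma row_update_exists x : exists y, row_update At s1 s2 x y.
Proof. by have [u [l [_ Hu _]]] := row_minimizer x.2; eexists; exists u. Qed.

Lemma col_update_exists x : exists y, col_update At s1 s2 x y.
Proof. by have [u [l [_ Hu _]]] := col_minimizer x.1; eexists; exists u. Qed.

Lemma ftilde_congr x y : M x = M y -> ftilde At x = ftilde At y.
Proof. by move=> h; rewrite !ftilde_rowsum h. Qed.

(** The projection following the minimisation preserves the scaled matrix, so
    the new point inherits the minimal value and the stationarity of the
    minimiser. *)
Lemma row_updateP x y : V0perp x -> row_update At s1 s2 x y ->
  [/\ V0perp y, forall u, hyperplane s1 u -> ftilde At y <= ftilde At (u, x.2)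
    & row_stationary At s1 y].
Proof.
move=> [[_ Hx2] _] [u [umin uuniq] ->]; split; first exact: P0_V0perp.
  move=> u' Hu'; rewrite (@ftilde_congr _ (u, x.2)).
    by case: umin => _; exact.
  by apply: exp_scaling_P0 => //; split=> //; exact: umin.1.
have [u' [l [_ [min' _] E]]] := row_minimizer x.2.
move=> w Hw; rewrite exp_scaling_P0//; last by split=> //; exact: umin.1.
rewrite (uuniq _ min'); under eq_bigr do rewrite E -mulrA.
by rewrite -mulr_sumr ((hyperplaneP _ _).1 Hw) mulr0.
Qed.

Lemma col_updateP x y : V0perp x -> col_update At s1 s2 x y ->
  [/\ V0perp y, forall v, hyperplane s2 v -> ftilde At y <= ftilde At (x.1, v)
    & col_stationary At s2 y].
Proof.
move=> [[Hx1 _] _] [u [umin uuniq] ->]; split; first exact: P0_V0perp.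
  move=> u' Hu'; rewrite (@ftilde_congr _ (x.1, u)).
    by case: umin => _; exact.
  by apply: exp_scaling_P0 => //; split=> //; exact: umin.1.
have [u' [l [_ [min' _] E]]] := col_minimizer x.1.
move=> w Hw; rewrite exp_scaling_P0//; last by split=> //; exact: umin.1.
rewrite (uuniq _ min'); under eq_bigr do rewrite E -mulrA.
by rewrite -mulr_sumr ((hyperplaneP _ _).1 Hw) mulr0.
Qed.

Lemma modified_stepP x y : V0perp x -> modified_step At s1 s2 x y ->
  [/\ V0perp y, ftilde At y <= ftilde At x
    & row_stationary At s1 y \/ col_stationary At s2 y].
Proof.
move=> Vx [[_ /(row_updateP Vx)[Vy le st]]|[_ /(col_updateP Vx)[Vy le st]]].
  by split=> //; [case: x Vx le => ? ? [[/= Hx _] _]; exact|left].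
by split=> //; [case: x Vx le => ? ? [[_ /= Hx] _]; exact|right].
Qed.

(** From a point that is stationary in one block, a step does at least as well
    as an exact minimisation in either block. It improves the minimum over the
    stationary block because it does not increase the objective. The greedy
    selection rule settles the other block: unless that block is the one
    updated, its gradient is no larger than the vanishing gradient of the
    first, and the point was already minimal in both. *)
Lemma modified_step_greedy x y : V0perp x ->
  row_stationary At s1 x \/ col_stationary At s2 x ->
  modified_step At s1 s2 x y ->
  (forall u, hyperplane s1 u -> ftilde At y <= ftilde At (u, x.2)) /\
  (forall v, hyperplane s2 v -> ftilde At y <= ftilde At (x.1, v)).
Proof.
move=> Vx st step; have [_ lexy _] := modified_stepP Vx step.
have rowmin : row_stationary At s1 x ->
    forall u, hyperplane s1 u -> ftilde At y <= ftilde At (u, x.2).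
  move=> rs u Hu; apply: le_trans lexy _.
  exact: (row_stationary_min At_ge0 rs Vx.1.1 Hu).
have colmin : col_stationary At s2 x ->
    forall v, hyperplane s2 v -> ftilde At y <= ftilde At (x.1, v).
  move=> rs v Hv; apply: le_trans lexy _.
  exact: (col_stationary_min At_ge0 rs Vx.1.2 Hv).
(* When the block just made stationary is updated again, its gradient, which is
   zero, is the larger one; hence the other block is stationary as well. *)
case: step => [[le /(row_updateP Vx)[_ leu _]]|[le /(col_updateP Vx)[_ leu _]]];
  split=> //.
  case: st => [rs|]; last exact: colmin.
  apply/colmin/(grad_along_W2_eq0 s1 s2 At_ge0)/(enorm_le0 le).
  exact/grad_along_W1_eq0.
case: st => [|cs]; first exact: rowmin.
apply/rowmin/(grad_along_W1_eq0 s1 s2 At_ge0)/(enorm_le0 le).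
exact/grad_along_W2_eq0.
Qed.

Lemma Ct_pairing_eq0 x : U x -> \sum_i \sum_j Ct i j * (x.1 i 0 + x.2 j 0) = 0.
Proof.
move=> [/hyperplaneP H1 /hyperplaneP H2]; rewrite pairing_marginals.
under eq_bigr do rewrite Ct_row.
by under [X in _ + X]eq_bigr do rewrite Ct_col; rewrite H1 H2 addr0.
Qed.

(** On V0perp the values u_i + v_j at the positive entries determine the point,
    since a point of V0perp where they all vanish is also in V0. *)
Lemma support_bound : exists c, forall x r, V0perp x -> 0 <= r ->
  (forall i j, 0 < At i j -> `|x.1 i 0 + x.2 j 0| <= r) -> `|x| <= r * c.
Proof.
pose T x : 'M[R]_(m, n) :=
  \matrix_(i, j) (if 0 < At i j then x.1 i 0 + x.2 j 0 else 0).
have Tlin : linear T.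
  move=> k x y; apply/matrixP => i j; rewrite !mxE.
  by case: ifP => _; rewrite ?mulr0 ?addr0//; ring.
pose Tm := GRing.isLinear.Build _ _ _ _ T Tlin.
pose TL : {linear E -> 'M[R]_(m, n)} := HB.pack T Tm.
have [V VP] := subspace_vspace (subspace_V0perp At s1 s2).
have inj x : x \in V -> linfun TL x = 0 -> x = 0.
  move=> /VP Vx; rewrite lfunE => /matrixP T0; apply: (V0_V0perp _ Vx).
  split; first exact: Vx.1.
  by move=> i j Aij; have := T0 i j; rewrite !mxE Aij.
have [g gK] := left_inverse_on inj.
have [c gc] := linear_mx_bounded g.
exists c => x r Vx r0 xr; rewrite -(gK x); last exact/VP.
apply: gc => i j; rewrite lfunE mxE.
by case: ifP => // Aij; [exact: xr|rewrite normr0].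
Qed.

(** A bound on the objective bounds u_i + v_j from above wherever the matrix is
    positive. The weights Ct are positive at exactly these places and pair to
    zero with (u, v), so the same numbers are bounded from below. *)
Lemma sublevel_bounded (K : R) :
  exists r, forall x, V0perp x -> ftilde At x <= K -> box r x.
Proof.
have [c hc] := support_bound.
pose K0 := \sum_i \sum_j `|ln (K / At i j)|.
pose S := \sum_i \sum_j Ct i j.
pose D := \sum_i \sum_j (Ct i j)^-1.
have sum_ge (F : 'I_m -> 'I_n -> R) i j : (forall i j, 0 <= F i j) ->
    F i j <= \sum_i \sum_j F i j.
  move=> F0; rewrite (bigD1 i)//= (bigD1 j)//= -addrA lerDl.
  by rewrite addr_ge0// ?sumr_ge0// => ? _; rewrite sumr_ge0.
have K00 : 0 <= K0 by rewrite sumr_ge0// => ? _; rewrite sumr_ge0.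
have S0 : 0 <= S by rewrite sumr_ge0// => ? _; rewrite sumr_ge0.
have Dj i j : (Ct i j)^-1 <= D.
  by apply: (sum_ge (fun i j => (Ct i j)^-1)) => k l; rewrite invr_ge0.
have D0 : 0 <= D.
  by rewrite sumr_ge0// => ? _; rewrite sumr_ge0// => *; rewrite invr_ge0.
exists ((K0 + K0 * S * D) * c) => x Vx xK.
pose t i j := x.1 i 0 + x.2 j 0.
have up i j : 0 < At i j -> t i j <= K0.
  move=> Aij; have le : At i j * expR (t i j) <= K.
    apply: le_trans xK.
    apply: (sum_ge (fun i j => At i j * expR (t i j))) => k l.
    by rewrite mulr_ge0// expR_ge0.
  have K_gt0 : 0 < K by apply: lt_le_trans le; rewrite mulr_gt0// expR_gt0.
  rewrite -(expRK (t i j)); apply: (@le_trans _ _ (ln (K / At i j))).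
    by rewrite ler_ln ?posrE ?expR_gt0 ?divr_gt0// ler_pdivlMr// mulrC.
  apply: le_trans (ler_norm _) _.
  by apply: (sum_ge (fun i j => `|ln (K / At i j)|)) => k l.
(* The gaps K0 - t, weighted by Ct, are nonnegative and sum to K0 * S. *)
have upC i j : 0 <= Ct i j * (K0 - t i j).
  have [C0|] := eqVneq (Ct i j) 0; first by rewrite C0 mul0r.
  rewrite neq_lt ltNge Ct_ge0/= => C_gt0.
  by rewrite mulr_ge0// subr_ge0 up// -Ct_gt0.
have sumE : \sum_i \sum_j Ct i j * (K0 - t i j) = K0 * S.
  have := Ct_pairing_eq0 Vx.1; rewrite -/(t _ _) => h.
  rewrite -[RHS]subr0 -[X in _ - X]h mulr_sumr -sumrB; apply: eq_bigr => i _.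
  by rewrite mulr_sumr -sumrB; apply: eq_bigr => j _; rewrite /t; ring.
apply/(box_le _ (box_norm x))/hc => //.
  by rewrite addr_ge0// !mulr_ge0.
move=> i j Aij; rewrite -/(t i j) ler_norml; apply/andP; split; last first.
  by rewrite (le_trans (up i j Aij))// lerDl !mulr_ge0.
have C_gt0 : 0 < Ct i j by rewrite Ct_gt0.
have le1 : Ct i j * (K0 - t i j) <= K0 * S by rewrite -sumE; exact: sum_ge.
have le2 : K0 - t i j <= K0 * S * D.
  apply: (@le_trans _ _ (K0 * S / Ct i j)).
    by rewrite ler_pdivlMr// mulrC.
  by rewrite ler_wpM2l// mulr_ge0.
lra.
Qed.

(** The factor l is common to rows and columns because s1 and s2 have equal
    sums; dividing by it gives the balanced scaling. *)
Definition critical x := V0perp x /\ exists l,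
  [/\ 0 < l, forall i, rowsum (M x) i = l * s1 i 0
    & forall j, colsum (M x) j = l * s2 j 0].

Lemma total_gt0 : 0 < \sum_i s1 i 0.
Proof.
by rewrite (bigD1 (Ordinal m_gt0))//= ltr_pwDl// sumr_ge0// => i _; exact: ltW.
Qed.

Lemma total_eq : \sum_i s1 i 0 = \sum_j s2 j 0.
Proof.
have := sum_rowsum Ct.
by under eq_bigr do rewrite Ct_row; under [in RHS]eq_bigr do rewrite Ct_col.
Qed.

Lemma block_min_critical x : V0perp x ->
  (forall u, hyperplane s1 u -> ftilde At x <= ftilde At (u, x.2)) ->
  (forall v, hyperplane s2 v -> ftilde At x <= ftilde At (x.1, v)) ->
  critical x.
Proof.
move=> Vx rmin cmin; split=> //.
have [u [l [l0 [_ uniqu] rE]]] := row_minimizer x.2.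
have [v [k [k0 [_ uniqv] cE]]] := col_minimizer x.1.
have ux : u = x.1.
  apply: uniqu; split; first exact: Vx.1.1.
  by move=> w /rmin; case: (x).
have vx : v = x.2.
  apply: uniqv; split; first exact: Vx.1.2.
  by move=> w /cmin; case: (x).
rewrite ux -surjective_pairing in rE; rewrite vx -surjective_pairing in cE.
have lk : l = k.
  apply: (mulIf (lt0r_neq0 total_gt0)); rewrite {2}total_eq !mulr_sumr.
  under eq_bigr do rewrite -rE.
  by under [in RHS]eq_bigr do rewrite -cE; exact: sum_rowsum.
by exists l; split=> //; rewrite lk.
Qed.

Lemma is_scaling_exp_scaling x l : 0 < l -> is_scaling At (l^-1 *: M x).
Proof.
move=> l0; exists (\row_i (l^-1 * expR (x.1 i 0))), (\row_j expR (x.2 j 0)).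
split; [by move=> i; rewrite mxE mulr_gt0 ?invr_gt0 ?expR_gt0|
        by move=> j; rewrite mxE expR_gt0|].
apply/matrixP => i j; rewrite mul_mx_diag mul_diag_mx !mxE expRD; ring.
Qed.

Lemma critical_balanced x : critical x -> exists l, [/\ 0 < l,
  is_scaling At (l^-1 *: M x) & balanced (const_mx 1) s1 s2 (l^-1 *: M x)].
Proof.
move=> [_ [l [l0 rE cE]]]; exists l; split=> //.
  exact: is_scaling_exp_scaling.
apply/balanced1P; split=> i; rewrite ?rowsumZ ?colsumZ ?rE ?cE mulKf//.
  exact: lt0r_neq0.
exact: lt0r_neq0.
Qed.

Lemma balanced_scaling_unique B B' :
  is_scaling At B -> balanced (const_mx 1) s1 s2 B ->
  is_scaling At B' -> balanced (const_mx 1) s1 s2 B' -> B = B'.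
Proof.
move=> sB /balanced1P[rB cB] sB' /balanced1P[rB' cB'].
by apply: (scaling_unique At_ge0) => // i; rewrite ?rB ?rB' ?cB ?cB'.
Qed.

(** Two critical points yield proportional matrices by uniqueness of the
    balanced scaling, so they differ by a constant value of u_i + v_j on the
    positive entries. Pairing with Ct shows that this constant is zero; the
    difference is then in V0 and in V0perp. *)
Lemma critical_unique x y : critical x -> critical y -> x = y.
Proof.
move=> cx cy.
have [l [l0 sx bx]] := critical_balanced cx.
have [k [k0 sy byy]] := critical_balanced cy.
have /matrixP E := balanced_scaling_unique sx bx sy byy.
have Ud : U (x - y) := subspaceB (subspace_spaceU s1 s2) cx.1.1 cy.1.1.
pose a := ln l - ln k.
have tE i j : 0 < At i j -> (x - y).1 i 0 + (x - y).2 j 0 = a.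
  move=> Aij; have := E i j; rewrite !mxE => e.
  have e' : expR (x.1 i 0 + x.2 j 0 - (y.1 i 0 + y.2 j 0)) = l / k.
    rewrite expRD expRN.
    set p := expR (_ + _) in e *; set q := expR (_ + _) in e *.
    have q0 : q != 0 by rewrite gt_eqF// expR_gt0.
    have : p / l = q / k.
      apply: (mulIf (lt0r_neq0 Aij)); rewrite -[LHS]mulrAC -[RHS]mulrAC.
      by move: e; rewrite ![_^-1 * _]mulrC.
    move=> /(congr1 (fun z => z * l / q)).
    by rewrite divfK ?gt_eqF// => ->; field; rewrite q0 gt_eqF.
  rewrite -[LHS](addrACA (x.1 i 0)) -opprD -[LHS]expRK e' ln_div ?posrE//.
have a0 : a = 0.
  have := Ct_pairing_eq0 Ud.
  have -> : \sum_i \sum_j Ct i j * ((x - y).1 i 0 + (x - y).2 j 0) =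
            a * \sum_i s1 i 0.
    rewrite mulr_sumr; apply: eq_bigr => i _; rewrite -Ct_row mulr_sumr.
    apply: eq_bigr => j _.
    have [->|] := eqVneq (Ct i j) 0; first by rewrite mul0r mulr0.
    by rewrite neq_lt ltNge Ct_ge0/= Ct_gt0 => /tE ->; rewrite mulrC.
  by move=> /eqP; rewrite mulf_eq0 (gt_eqF total_gt0) orbF => /eqP.
apply/subr0_eq/(V0_V0perp (At := At) (s1 := s1) (s2 := s2)).
  by split=> // i j /tE ->.
by apply: subspaceB; [exact: subspace_V0perp|exact: cx.1|exact: cy.1].
Qed.

Section Run.
Variables (x0 : E) (x : nat -> E).
Hypothesis V0perp_x0 : V0perp x0.
Hypothesis run : modified_run At s1 s2 x0 x.

Lemma run_V0perp k : V0perp (x k).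
Proof.
by elim: k => [|k IH]; [rewrite run.1|have [] := modified_stepP IH (run.2 k)].
Qed.

Lemma run_nonincreasing j k : (j <= k)%N -> ftilde At (x k) <= ftilde At (x j).
Proof.
elim: k => [|k IH]; first by rewrite leqn0 => /eqP ->.
rewrite leq_eqVlt => /orP[/eqP -> //|/IH]; apply: le_trans.
by have [] := modified_stepP (run_V0perp k) (run.2 k).
Qed.

(** As the objective decreases along the run, its value at a cluster point y is
    a lower bound for all its values, hence also for the block minima at the
    iterates after the first, which the next step attains or improves on. These
    comparisons are closed conditions on the iterate, so they hold at y itself:
    y minimises the objective in each block. *)
Lemma run_cluster_critical y : cluster (x k @[k --> \oo]) y -> critical y.
Proof.
move=> cy.
have fy j : ftilde At y <= ftilde At (x j).
  apply: (cluster_seq_closed (k0 := j)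
           (S := [set z | ftilde At z <= ftilde At (x j)])) cy => //.
    apply: continuous_closed_le; last by move=> z; exact: cst_continuous.
    by apply: (continuous_ftilde_comp (f := id));
      [exact: coord1_continuous|exact: coord2_continuous].
  by move=> k; exact: run_nonincreasing.
have greedy k : (1 <= k)%N ->
    (forall u, hyperplane s1 u ->
       ftilde At (x k.+1) <= ftilde At (u, (x k).2)) /\
    (forall v, hyperplane s2 v ->
       ftilde At (x k.+1) <= ftilde At ((x k).1, v)).
  case: k => // k _; have [_ _ st] := modified_stepP (run_V0perp k) (run.2 k).
  exact: modified_step_greedy (run_V0perp _) st (run.2 _).
apply: block_min_critical.
- apply: (cluster_seq_closed (k0 := 0) (@closed_V0perp _ _ _ At s1 s2)) cy.
  by move=> k _; exact: run_V0perp.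
- move=> u Hu.
  apply: (cluster_seq_closed (k0 := 1)
           (S := [set z | ftilde At y <= ftilde At (u, z.2)])) cy => //.
    apply: continuous_closed_le; first by move=> z; exact: cst_continuous.
    apply: (continuous_ftilde_comp (f := fun z => (u, z.2)));
      last exact: coord2_continuous.
    by move=> i z; exact: cst_continuous.
  by move=> k k1; apply: le_trans (fy k.+1) _; apply: (greedy k k1).1.
- move=> v Hv.
  apply: (cluster_seq_closed (k0 := 1)
           (S := [set z | ftilde At y <= ftilde At (z.1, v)])) cy => //.
    apply: continuous_closed_le; first by move=> z; exact: cst_continuous.
    apply: (continuous_ftilde_comp (f := fun z => (z.1, v)));
      first exact: coord1_continuous.
    by move=> i z; exact: cst_continuous.
  by move=> k k1; apply: le_trans (fy k.+1) _; apply: (greedy k k1).2.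
Qed.

(** The run stays in a compact box and its cluster points are critical, hence
    all equal. Criticality of the limit makes this at the same time the
    existence proof for the balanced scaling. *)
Lemma run_cvg : exists y, critical y /\ x k @[k --> \oo] --> y.
Proof.
have [r xr] := sublevel_bounded (ftilde At (x 0)).
have box_x k : box r (x k).
  by apply: xr; [exact: run_V0perp|exact: run_nonincreasing].
have [y [box_y cy]] : box r `&` cluster (x k @[k --> \oo]) !=set0.
  have Fbox : (x k @[k --> \oo]) (box r) by exists 0%N => // k _; exact: box_x.
  exact: (@compact_box R m n r _ _ Fbox).
have crit_y := run_cluster_critical cy.
exists y; split=> //.
(* The box is enlarged so as to be a neighbourhood of y. *)
apply: (compact_cluster_set1 _ (compact_box (r := r + 1))).
- exact: norm_hausdorff.
- exact: nbhs_box.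
- by exists 0%N => // k _; apply: (box_le _ (box_x k)); rewrite lerDl.
- apply/seteqP; split=> [z /run_cluster_critical crit_z|z ->//].
  exact: critical_unique crit_z crit_y.
Qed.

End Run.

(** Both updates exist and the two gradient norms are comparable, so every point
    of V0perp has a successor. *)
Lemma run_exists x0 : V0perp x0 ->
  exists x : nat -> E, modified_run At s1 s2 x0 x.
Proof.
move=> Vx0.
have step x : exists y, V0perp x -> modified_step At s1 s2 x y.
  have [y ry] := row_update_exists x.
  have [z cz] := col_update_exists x.
  have [le|/ltW le] := leP (enorm (grad_along At s1 s2 (W2 At s1 s2) x))
                     (enorm (grad_along At s1 s2 (W1 At s1 s2) x)).
    by exists y => _; left.
  by exists z => _; right.
have [g gP] := choice step.
pose x k := iter k g x0.
suff Vx k : V0perp (x k) by exists x; split=> // k; exact: gP.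
elim: k => //= k IH.
by have [] := modified_stepP IH (gP _ IH).
Qed.

Lemma balanced_scaling_exists :
  exists B, is_scaling At B /\ balanced (const_mx 1) s1 s2 B.
Proof.
have V0perp_0 : V0perp 0 by exact: (subspace_V0perp At s1 s2).1.
have [x run] := run_exists V0perp_0.
have [y [/critical_balanced[l [_ sc bal]] _]] := run_cvg V0perp_0 run.
by exists (l^-1 *: M y).
Qed.

Lemma run_cvg_scaling x0 (x : nat -> E) B :
  V0perp x0 -> modified_run At s1 s2 x0 x ->
  is_scaling At B -> balanced (const_mx 1) s1 s2 B ->
  exists y, x k @[k --> \oo] --> y /\ exists2 mu, 0 < mu & M y = mu *: B.
Proof.
move=> Vx0 run sc bal.
have [y [/critical_balanced[l [l_gt0 sc' bal']] xy]] := run_cvg Vx0 run.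
exists y; split=> //; exists l => //.
rewrite (balanced_scaling_unique sc bal sc' bal').
by rewrite scalerA divff ?scale1r// gt_eqF.
Qed.

End Feasible.

(** * Column weights *)

(** Multiplication by the positive matrix diag(a) on the right turns the balance
    conditions with column weights a into prescribed row and column sums, and it
    is bijective, so all questions about A transfer to A diag(a). *)
Section ColumnWeights.
Context {R : realType} {m n : nat}.
Variables (a : 'cV[R]_n) (a_gt0 : forall j, 0 < a j 0).
Implicit Types A B : 'M[R]_(m, n).

Lemma mul_diagE B i j : (B *m diag_mx a^T) i j = B i j * a j 0.
Proof. by rewrite mul_mx_diag !mxE. Qed.

Lemma mul_diag_inj : injective (fun B => B *m diag_mx a^T).
Proof.
move=> B B' /matrixP h; apply/matrixP => i j; have := h i j; rewrite !mul_diagE.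
by apply: mulIf; rewrite gt_eqF.
Qed.

Lemma mul_diag_surj A : exists B, B *m diag_mx a^T = A.
Proof.
exists (\matrix_(i, j) (A i j / a j 0)); apply/matrixP => i j.
by rewrite mul_diagE mxE divfK// gt_eqF.
Qed.

Lemma mul_diag_ge0 B : nonneg_mx B -> nonneg_mx (B *m diag_mx a^T).
Proof. by move=> B0 i j; rewrite mul_diagE mulr_ge0// ltW. Qed.

Lemma mul_diag_zero_pattern A B : same_zero_pattern B A ->
  same_zero_pattern (B *m diag_mx a^T) (A *m diag_mx a^T).
Proof.
move=> BA i j; rewrite !mul_diagE.
have cancel (z : R) : z * a j 0 = 0 <-> z = 0.
  split=> [/eqP|->]; last exact: mul0r.
  by rewrite mulf_eq0 (gt_eqF (a_gt0 j)) orbF => /eqP.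
by split=> /cancel/BA/cancel.
Qed.

Lemma mul_diag_balanced (b : 'cV[R]_m) (c : 'cV[R]_n) B :
  balanced a b c B <->
  balanced (const_mx 1) b (\col_j (c j 0 * a j 0)) (B *m diag_mx a^T).
Proof.
rewrite balanced1P.
have rE i : rowsum (B *m diag_mx a^T) i = (B *m a) i 0.
  by rewrite mxE; apply: eq_bigr => j _; rewrite mul_diagE.
have cE j : colsum (B *m diag_mx a^T) j =
    (B^T *m (const_mx 1 : 'cV[R]_m)) j 0 * a j 0.
  by rewrite mxE mulr_suml; apply: eq_bigr => i _; rewrite mul_diagE !mxE mulr1.
split=> [[Ba Bc]|[hr hc]].
  by split=> [i|j]; rewrite ?rE ?Ba// cE Bc mxE.
split; apply/matrixP => i j; rewrite !ord1; first by rewrite -rE hr.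
by apply: (mulIf (lt0r_neq0 (a_gt0 i))); rewrite -cE hc mxE.
Qed.

Lemma mul_diag_scaling A B :
  is_scaling A B <-> is_scaling (A *m diag_mx a^T) (B *m diag_mx a^T).
Proof.
have comm (d : 'rV[R]_n) : diag_mx d *m diag_mx a^T = diag_mx a^T *m diag_mx d.
  exact: diag_mxC.
split=> [[d1 [d2 [d1_gt0 d2_gt0 ->]]]|[d1 [d2 [d1_gt0 d2_gt0 e]]]];
  exists d1, d2; split=> //; last apply: mul_diag_inj; rewrite /= ?e.
  by rewrite -!mulmxA comm.
by rewrite -!mulmxA comm.
Qed.

End ColumnWeights.

Lemma scaling_ge0_zero_pattern (R : realType) m n (A B : 'M[R]_(m, n)) :
  nonneg_mx A -> is_scaling A B -> nonneg_mx B /\ same_zero_pattern B A.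
Proof.
move=> A_ge0 [d1 [d2 [d1_gt0 d2_gt0 ->]]]; split=> i j;
  rewrite mul_mx_diag mul_diag_mx !mxE; first by rewrite !mulr_ge0// ltW.
split=> [/eqP|->]; last by rewrite mulr0 mul0r.
by rewrite !mulf_eq0 (gt_eqF (d1_gt0 i)) (gt_eqF (d2_gt0 j)) orbF => /eqP.
Qed.

Theorem theorem5p2 (R : realType) (m n : nat) (hm : (2 <= m)%N) (hn : (2 <= n)%N)
    (A : 'M[R]_(m, n)) (hA : nonneg_mx A)
    (b : 'cV[R]_m) (a c : 'cV[R]_n)
    (hb : forall i, 0 < b i 0) (ha : forall j, 0 < a j 0)
    (hc : forall j, 0 < c j 0)
    (hsum : c^T *m a = (const_mx 1 : 'cV[R]_m)^T *m b) :
  let feasible := exists C : 'M[R]_(m, n),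
    [/\ nonneg_mx C, same_zero_pattern C A & balanced a b c C] in
  let At : 'M[R]_(m, n) := A *m diag_mx a^T in
  let s1 : 'cV[R]_m := b in
  let s2 : 'cV[R]_n := \col_j (c j 0 * a j 0) in
  ((exists B : 'M[R]_(m, n), is_scaling A B /\ balanced a b c B) <-> feasible)
  /\
  (feasible ->
   exists B : 'M[R]_(m, n),
     [/\ unique (fun B' => is_scaling A B' /\ balanced a b c B') B,
         unique (fun B' => is_scaling At B' /\ balanced (const_mx 1) s1 s2 B')
                (B *m diag_mx a^T),
         (* both kinds of updates are always defined *)
         forall x, V0perp At s1 s2 x ->
           (exists y, row_update At s1 s2 x y) /\
           (exists y, col_update At s1 s2 x y)
       & forall x0, V0perp At s1 s2 x0 ->
           (exists x : nat -> 'cV[R]_m * 'cV[R]_n,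
              modified_run At s1 s2 x0 x) /\
           (forall x : nat -> 'cV[R]_m * 'cV[R]_n,
              modified_run At s1 s2 x0 x ->
              exists xstar : 'cV[R]_m * 'cV[R]_n,
                (x k @[k --> \oo] --> xstar) /\
                exists2 mu : R, 0 < mu &
                  exp_scaling At xstar = mu *: (B *m diag_mx a^T))]).
Proof.
move=> feasible At s1 s2.
have m_gt0 : (0 < m)%N by exact: leq_trans hm.
have n_gt0 : (0 < n)%N by exact: leq_trans hn.
have s2_gt0 j : 0 < s2 j 0 by rewrite mxE mulr_gt0.
have At_ge0 : nonneg_mx At by exact: mul_diag_ge0.
have feasible_At : feasible -> exists Ct : 'M[R]_(m, n),
    [/\ nonneg_mx Ct, same_zero_pattern Ct At,
        forall i, rowsum Ct i = s1 i 0 & forall j, colsum Ct j = s2 j 0].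
  move=> [C [C_ge0 CA /(mul_diag_balanced ha)/balanced1P[Ct_row Ct_col]]].
  exists (C *m diag_mx a^T); split=> //; first exact: mul_diag_ge0.
  exact: mul_diag_zero_pattern.
have scaling_exists : feasible -> exists B, is_scaling A B /\ balanced a b c B.
  move=> /feasible_At[Ct [Ct_ge0 CtAt Ct_row Ct_col]].
  have [Bt] := balanced_scaling_exists m_gt0 n_gt0 hb s2_gt0 At_ge0 Ct_ge0 CtAt
    Ct_row Ct_col.
  have [B <-] := mul_diag_surj ha Bt.
  move=> [sc bal]; exists B.
  by split; [exact/(mul_diag_scaling ha)|exact/(mul_diag_balanced ha)].
split.
  split=> [[B [sc bal]]|]; last exact: scaling_exists.
  by have [B_ge0 BA] := scaling_ge0_zero_pattern hA sc; exists B.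
move=> feas; have [B [sc bal]] := scaling_exists feas.
have [Ct [Ct_ge0 CtAt Ct_row Ct_col]] := feasible_At feas.
have /(mul_diag_scaling ha) sct := sc.
have /(mul_diag_balanced ha) balt := bal.
exists B; split.
- split=> // B' [/(mul_diag_scaling ha) sc' /(mul_diag_balanced ha) bal'].
  exact/(mul_diag_inj ha)/(balanced_scaling_unique At_ge0 sct balt sc' bal').
- split=> // B' [sc' bal'].
  exact: (balanced_scaling_unique At_ge0 sct balt sc' bal').
- move=> x _; split.
    exact: (row_update_exists s2 m_gt0 hb At_ge0 Ct_ge0 CtAt Ct_row).
  exact: (col_update_exists s1 n_gt0 s2_gt0 At_ge0 Ct_ge0 CtAt Ct_col).
- move=> x0 Vx0; split=> [|x run].
    exact: (run_exists m_gt0 n_gt0 hb s2_gt0 At_ge0 Ct_ge0 CtAt Ct_row Ct_col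
              Vx0).
  exact: (run_cvg_scaling m_gt0 n_gt0 hb s2_gt0 At_ge0 Ct_ge0 CtAt Ct_row Ct_col
            Vx0 run sct balt).
Qed.
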